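(* Let $n\ge1$ be an integer, let $$\vartheta_n(x):=\frac1{(1+x)^{2n}}\sum_{k=0}^\infty\binom{n+k-1}k^2\left(\frac x{1+x}\right)^{2k},\quad x\ge0,$$ and let $\epsilon:=\inf_{x\ge0}\vartheta_n(x)$. Then for all $f,g\in C_b[0,\infty)$ and all $x\ge0$, $$|T(f,g;x)|\le\frac12(1-\vartheta_n(x))\cdot osc_{A_n}(f)\cdot osc_{A_n}(g)\le\frac12(1-\epsilon)\cdot osc_{A_n}(f)\cdot osc_{A_n}(g).$$
   Context: $C_b[0,\infty)$ is the set of continuous bounded real-valued functions on $[0,\infty)$. $A_n$ is the Baskakov operator $A_n(f;x):=\sum_{k=0}^\infty f\left(\frac kn\right)\binom{n+k-1}k\frac{x^k}{(1+x)^{n+k}}$, $x\in[0,\infty)$, and $T(f,g;x):=A_n(fg;x)-A_n(f;x)A_n(g;x)$. The oscillation is $osc_{A_n}(f):=\sup\{|f(k/n)-f(l/n)|:0\le k<l<\infty\}$ ($k,l$ integers), and similarly for $g$. *)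

(* Defs.v *)
From HB Require Import structures.
From mathcomp Require Import all_boot all_order all_algebra.
From mathcomp Require Import all_classical all_reals all_analysis.
Set Implicit Arguments.
Unset Strict Implicit.
Unset Printing Implicit Defensive.
Import Order.TTheory GRing.Theory Num.Theory.
Import numFieldNormedType.Exports.
Local Open Scope classical_set_scope.
Local Open Scope ring_scope.

(* Functions on [0, +oo) are represented by functions on R; everything below
   only uses their values on [0, +oo), and continuity is relative to that set,
   hence one-sided at 0. *)
Definition Cb (R : realType) : set (R -> R) :=
  [set f : R -> R | {within `[(0 : R), +oo[, continuous f} /\
           [bounded f t | t in `[(0 : R), +oo[]].

(* The infinite sums are limits of real partial sums; they converge for n >= 1,
   0 <= x and f bounded. *)
Definition baskakov (R : realType) (n : nat) (f : R -> R) (x : R) : R :=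
  limn [series f (k%:R / n%:R) * 'C(n + k - 1, k)%:R
                 * (x ^+ k / (1 + x) ^+ (n + k))]_k.

Definition chebyshev_T (R : realType) (n : nat) (f g : R -> R) (x : R) : R :=
  baskakov n (fun t => f t * g t) x - baskakov n f x * baskakov n g x.

Definition osc (R : realType) (n : nat) (f : R -> R) : R :=
  sup [set d | exists k l : nat,
    (k < l)%N /\ d = `|f (k%:R / n%:R) - f (l%:R / n%:R)|].

Definition vartheta (R : realType) (n : nat) (x : R) : R :=
  1 / (1 + x) ^+ (2 * n) *
  limn [series 'C(n + k - 1, k)%:R ^+ 2 * (x / (1 + x)) ^+ (2 * k)]_k.

Definition epsilon (R : realType) (n : nat) : R :=
  inf [set vartheta n x | x in `[(0 : R), +oo[].

(* Main.v *)
(** With the weights [p_k = C(n+k-1,k) x^k / (1+x)^(n+k)], which sum to [1], the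
    Chebyshev functional is the covariance
    [T(f,g;x) = 1/2 sum_(k,l) p_k p_l (f(k/n) - f(l/n)) (g(k/n) - g(l/n))].
    Its diagonal terms vanish and the others are at most [osc f * osc g] times
    [p_k p_l], while [sum_(k <> l) p_k p_l = 1 - sum_k p_k^2 = 1 - vartheta_n x].
    The covariance identity is applied to partial sums, where it holds with an
    additional factor [sum_(k < N) p_k -> 1]. *)

Require Import Defs.
From HB Require Import structures.
From mathcomp Require Import all_boot all_order all_algebra.
From mathcomp Require Import all_classical all_reals all_analysis.
From mathcomp Require Import ring lra.
Import Order.TTheory GRing.Theory Num.Theory.
Import numFieldNormedType.Exports.
Local Open Scope classical_set_scope.
Local Open Scope ring_scope.

(** * Covariance identity and bound for finite weighted sums *)

Lemma weighted_covarianceE (R : realFieldType) (N : nat) (p a b : nat -> R) :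
  (\sum_(k < N) p k) * (\sum_(k < N) p k * (a k * b k))
    - (\sum_(k < N) p k * a k) * (\sum_(k < N) p k * b k) =
  1 / 2 * \sum_(k < N) \sum_(l < N) p k * p l * ((a k - a l) * (b k - b l)).
Proof.
(* Each of the four terms of the expanded product separates into a sum over [k] times a sum over
   [l]; they agree in pairs, which absorbs the [1 / 2]. *)
suff -> : \sum_(k < N) \sum_(l < N) p k * p l * ((a k - a l) * (b k - b l)) =
    (\sum_(k < N) p k * (a k * b k)) * (\sum_(k < N) p k)
    + (\sum_(k < N) p k) * (\sum_(k < N) p k * (a k * b k))
    - (\sum_(k < N) p k * a k) * (\sum_(k < N) p k * b k)
    - (\sum_(k < N) p k * b k) * (\sum_(k < N) p k * a k) by field.
rewrite !big_distrlr /= -big_split -!sumrB; apply: eq_bigr => k _.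
by rewrite -big_split -!sumrB; apply: eq_bigr => l _ /=; ring.
Qed.

Lemma weighted_covariance_le (R : realFieldType) (N : nat) (p a b : nat -> R)
    (da db : R) :
  (forall k, 0 <= p k) ->
  (forall k l, `|a k - a l| <= da) -> (forall k l, `|b k - b l| <= db) ->
  `|(\sum_(k < N) p k) * (\sum_(k < N) p k * (a k * b k))
    - (\sum_(k < N) p k * a k) * (\sum_(k < N) p k * b k)|
  <= 1 / 2 * ((\sum_(k < N) p k) ^+ 2 - \sum_(k < N) p k ^+ 2) * da * db.
Proof.
move=> p0 ha hb; rewrite weighted_covarianceE normrM ger0_norm; last by lra.
rewrite -(mulrA _ da) -[leRHS]mulrA ler_wpM2l//.
(* The square of the sum is a full double sum; subtracting the squares removes its diagonal. *)
have -> : ((\sum_(k < N) p k) ^+ 2 - \sum_(k < N) p k ^+ 2) * (da * db) =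
    \sum_(k < N) \sum_(l < N | l != k) p k * p l * (da * db).
  rewrite expr2 big_distrlr /= -sumrB mulr_suml; apply: eq_bigr => k _.
  by rewrite -mulr_suml (bigD1 k)//= expr2 addrAC subrr add0r.
apply: le_trans (ler_norm_sum _ _ _) _; apply: ler_sum => k _.
rewrite (bigD1 k)//= !subrr mul0r mulr0 add0r.
apply: le_trans (ler_norm_sum _ _ _) _; apply: ler_sum => l _.
rewrite !normrM !(ger0_norm (p0 _)) ler_wpM2l ?mulr_ge0//.
by rewrite ler_pM.
Qed.

(** * Passage to infinite sums *)

(** Absolute convergence, by comparison with [M *: p]. *)
Lemma is_cvg_series_weighted (R : realType) (p a : nat -> R) (M : R) :
  (forall k, 0 <= p k) -> cvgn (series p) -> (forall k, `|a k| <= M) ->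
  cvgn [series p k * a k]_k.
Proof.
move=> p0 cp aM; apply: normed_cvg.
apply: (@series_le_cvg _ _ (M *: p)).
- by move=> k /=.
- by move=> k; rewrite /= mulr_ge0// (le_trans _ (aM 0%N)).
- by move=> k /=; rewrite normrM ger0_norm// [leRHS]mulrC ler_wpM2l.
- exact: is_cvg_seriesZ.
Qed.

(** Nonnegative terms are bounded by the sum [l], so [p k ^+ 2] is the weight [p k] times a bounded
    sequence. *)
Lemma is_cvg_series_sqr (R : realType) (p : nat -> R) (l : R) :
  (forall k, 0 <= p k) -> series p @ \oo --> l -> cvgn [series p k ^+ 2]_k.
Proof.
move=> p0 pl; have cp : cvgn (series p) by apply/cvg_ex; exists l.
have ple k : `|p k| <= l.
  rewrite ger0_norm//.
  have hm : {homo series p : n m / (n <= m)%N >-> n <= m}.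
    exact: nondecreasing_series.
  have := nondecreasing_cvgn_le hm cp k.+1.
  rewrite (cvg_lim _ pl)//; apply: le_trans.
  by rewrite seriesSr lerDr sumr_ge0.
exact: (is_cvg_series_weighted _ _ _ _ p0 cp ple).
Qed.

Lemma weighted_covariance_lim_le (R : realType) (p a b : nat -> R)
    (Ma Mb da db : R) :
  (forall k, 0 <= p k) -> series p @ \oo --> (1 : R) ->
  (forall k, `|a k| <= Ma) -> (forall k, `|b k| <= Mb) ->
  (forall k l, `|a k - a l| <= da) -> (forall k l, `|b k - b l| <= db) ->
  `|limn [series p k * (a k * b k)]_k
     - limn [series p k * a k]_k * limn [series p k * b k]_k|
  <= 1 / 2 * (1 - limn [series p k ^+ 2]_k) * da * db.
Proof.
move=> p0 p1 aM bM ha hb.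
have cp : cvgn (series p) by apply/cvg_ex; exists 1.
have ca := is_cvg_series_weighted _ _ _ _ p0 cp aM.
have cb := is_cvg_series_weighted _ _ _ _ p0 cp bM.
have abM k : `|a k * b k| <= Ma * Mb by rewrite normrM ler_pM.
have cab := is_cvg_series_weighted _ _ _ _ p0 cp abM.
have cpp := is_cvg_series_sqr _ _ _ p0 p1.
pose L N := `|series p N * [series p k * (a k * b k)]_k N
  - [series p k * a k]_k N * [series p k * b k]_k N|.
pose U N := 1 / 2 * (series p N ^+ 2 - [series p k ^+ 2]_k N) * da * db.
have hL : L @ \oo --> `|1 * limn [series p k * (a k * b k)]_k
     - limn [series p k * a k]_k * limn [series p k * b k]_k|.
  by apply: cvg_norm; apply: cvgB; apply: cvgM.
have hU : U @ \oo --> 1 / 2 * (1 ^+ 2 - limn [series p k ^+ 2]_k) * da * db.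
  apply: cvgMr_tmp; apply: cvgMr_tmp; apply: cvgMl_tmp; apply: cvgB => //.
  by apply: cvgM.
(* The factors [1] and [1 ^+ 2] are made visible as the limits of [series p N] and its square. *)
rewrite -[limn [series p k * (a k * b k)]_k]mul1r.
rewrite -[X in (X - limn _)](expr1n _ 2).
apply: (ler_cvg_to hL hU); apply: nearW => N.
rewrite /L /U !seriesEord /=.
exact: weighted_covariance_le.
Qed.

(** * The negative binomial series *)

(* Partial sums of [(1 - y) (1 - y)^-(n+2) = (1 - y)^-(n+1)]; the last term is the
   truncation error. *)
Lemma negative_binomial_recr (R : comRingType) (n N : nat) (y : R) :
  (1 - y) * [series 'C(n.+1 + k, k)%:R * y ^+ k]_k N.+1 =
  [series 'C(n + k, k)%:R * y ^+ k]_k N.+1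
  - y * ('C(n.+1 + N, N)%:R * y ^+ N).
Proof.
rewrite !seriesEord /=; elim: N => [|N IH].
  by rewrite !big_ord_recr !big_ord0 /= !addn0 !bin0; ring.
rewrite big_ord_recr mulrDr IH [in RHS]big_ord_recr /=.
have -> : 'C(n.+1 + N.+1, N.+1) = ('C(n + N.+1, N.+1) + 'C(n.+1 + N, N))%N.
  by rewrite addSn binS addnS addSn.
by rewrite natrD exprS; ring.
Qed.

(** Induction on [n] from the geometric series: the recurrence on partial sums divides the limit by
    [1 - y], once convergence is known and the truncation error tends to [0]. *)
Lemma cvg_negative_binomial (R : realType) (n : nat) (y : R) :
  0 <= y -> y < 1 ->
  [series 'C(n + k, k)%:R * y ^+ k]_k @ \oo --> ((1 - y) ^- n.+1 : R).
Proof.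
move=> y0 y1; have ny : 0 < 1 - y by lra.
elim: n => [|n IH].
  rewrite (_ : (fun k => _) = geometric 1 y); last first.
    by apply/funext => k /=; rewrite add0n binn.
  rewrite expr1 -[X in _ --> X]mul1r.
  by apply: cvg_geometric_series; rewrite ger0_norm.
set t := fun k => 'C(n.+1 + k, k)%:R * y ^+ k.
have t0 k : 0 <= t k by rewrite /t mulr_ge0 ?exprn_ge0.
have u0 k : 0 <= 'C(n + k, k)%:R * y ^+ k by rewrite mulr_ge0 ?exprn_ge0.
have hm : {homo series t : n m / (n <= m)%N >-> n <= m}.
  by apply: nondecreasing_series => k _ _; exact: t0.
have hmu : {homo [series 'C(n + k, k)%:R * y ^+ k]_k
    : n m / (n <= m)%N >-> n <= m}.
  by apply: nondecreasing_series => k _ _; exact: u0.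
(* Dropping the nonnegative truncation error from the recurrence bounds the monotone partial
   sums. *)
have ct : cvgn (series t).
  apply: nondecreasing_is_cvgn => //.
  exists ((1 - y) ^- n.+1 / (1 - y)) => _ [N _ <-].
  apply: le_trans (hm _ _ (leqnSn N)) _.
  rewrite ler_pdivlMr// mulrC negative_binomial_recr.
  have cu : cvgn [series 'C(n + k, k)%:R * y ^+ k]_k.
    by apply/cvg_ex; exists ((1 - y) ^- n.+1).
  have := nondecreasing_cvgn_le hmu cu N.+1.
  rewrite (cvg_lim _ IH)//; apply: le_trans.
  by rewrite gerBl; exact: mulr_ge0 y0 (t0 N).
(* The truncation error is [y] times the general term of a convergent series, hence the limit
   [y * 0]. *)
have h : (fun N => (1 - y) * series t N.+1) @ \oo --> (1 - y) ^- n.+1 - y * 0.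
  under eq_fun do rewrite negative_binomial_recr.
  apply: cvgB; first by rewrite (cvg_shiftS (series _)).
  by apply: cvgMl_tmp; apply: cvg_series_cvg_0.
rewrite -(cvg_shiftS (series t)) /=.
have -> : (1 - y) ^- n.+2 = (1 - y)^-1 * ((1 - y) ^- n.+1 - y * 0).
  by rewrite mulr0 subr0 exprS invfM.
rewrite (_ : (fun N => series t N.+1) =
  (fun N => (1 - y)^-1 * ((1 - y) * series t N.+1))).
  exact: cvgMl_tmp.
by apply/funext => N; rewrite mulKf// gt_eqF.
Qed.

(** * Baskakov weights and [vartheta] *)

(** For [1 <= n] and [0 <= x], the negative binomial distribution: [k] failures before the [n]-th
    success, with success probability [1 / (1 + x)]. *)
Definition baskakov_weight (R : realType) (n : nat) (x : R) (k : nat) : R :=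
  'C(n + k - 1, k)%:R * (x ^+ k / (1 + x) ^+ (n + k)).

Section baskakov_weight.
Variables (R : realType) (n : nat) (x : R).
Hypotheses (n1 : (1 <= n)%N) (x0 : 0 <= x).
Local Notation p := (baskakov_weight R n x).

Lemma baskakov_weight_ge0 k : 0 <= p k.
Proof. by rewrite mulr_ge0// divr_ge0// exprn_ge0// addr_ge0. Qed.

Lemma baskakov_weightE k :
  p k = (1 + x) ^- n * ('C(n + k - 1, k)%:R * (x / (1 + x)) ^+ k).
Proof. by rewrite /p exprD expr_div_n invfM; ring. Qed.

(** The negative binomial series at [y = x / (1 + x)], where [1 - y = (1 + x)^-1]. *)
Lemma cvg_series_baskakov_weight : series p @ \oo --> (1 : R).
Proof.
have x1 : 0 < 1 + x by rewrite ltr_pwDl.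
have x1n : 1 + x != 0 by rewrite gt_eqF.
have -> : (1 : R) = (1 + x) ^- n * (1 - x / (1 + x)) ^- n.
  have -> : 1 - x / (1 + x) = (1 + x)^-1 by field.
  by rewrite exprVn invrK mulVf// expf_neq0.
rewrite (_ : series _ = fun N => (1 + x) ^- n *
    [series 'C(n.-1 + k, k)%:R * (x / (1 + x)) ^+ k]_k N).
  (* The exponent is put in the successor form [n.-1.+1] of the series lemma, which is possible
     because [1 <= n]. *)
  apply: cvgMl_tmp; rewrite -[in _ ^- n](prednK n1).
  apply: cvg_negative_binomial.
    by rewrite divr_ge0// ltW.
  by rewrite ltr_pdivrMr// mul1r ltrDr.
apply/funext => N; rewrite !seriesEord /= mulr_sumr.
apply: eq_bigr => k _.
by rewrite baskakov_weightE -[in (n + k)%N](prednK n1) addSn subn1.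
Qed.

Lemma baskakovE f : baskakov n f x = limn [series p k * f (k%:R / n%:R)]_k.
Proof.
rewrite /baskakov; congr (limn (series _)); apply/funext => k.
by rewrite /= -mulrA mulrC.
Qed.

Lemma is_cvg_series_baskakov_weight_sqr : cvgn [series p k ^+ 2]_k.
Proof.
exact: (is_cvg_series_sqr _ _ _ baskakov_weight_ge0 cvg_series_baskakov_weight).
Qed.

(** Identifies [vartheta] as the probability that two independent draws from the weights
    coincide. *)
Lemma varthetaE : vartheta n x = limn [series p k ^+ 2]_k.
Proof.
have x1n : (1 + x) ^+ (2 * n) != 0 by rewrite expf_neq0// gt_eqF// ltr_pwDl.
rewrite /vartheta (_ : (fun k => 'C(n + k - 1, k)%:R ^+ 2 * _) =
    (1 + x) ^+ (2 * n) *: (fun k => p k ^+ 2)).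
  rewrite lim_seriesZ; last exact: is_cvg_series_baskakov_weight_sqr.
  by rewrite -[_ *: _]/(_ * _) mulrA div1r mulVf// mul1r.
apply/funext => k; rewrite [RHS]/GRing.scale /= baskakov_weightE.
rewrite -[RHS]/(_ * _) ![(2 * _)%N]mulnC !exprM -!exprMn mulVKf//.
by rewrite expf_neq0// gt_eqF// ltr_pwDl.
Qed.

Lemma vartheta_ge0 : 0 <= vartheta n x.
Proof.
rewrite varthetaE; apply: limr_ge; first exact: is_cvg_series_baskakov_weight_sqr.
by apply: nearW => N; rewrite sumr_ge0// => k _; rewrite sqr_ge0.
Qed.
End baskakov_weight.

Lemma epsilon_le_vartheta (R : realType) (n : nat) (x : R) :
  (1 <= n)%N -> 0 <= x -> epsilon R n <= vartheta n x.
Proof.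
move=> n1 x0; apply: ge_inf; last by exists x; rewrite //= in_itv /= x0.
(* [inf] is a lower bound only for a set bounded below; [0] serves. *)
exists 0 => _ [t + <-]; rewrite /= in_itv /= andbT => t0.
exact: vartheta_ge0.
Qed.

(** * Oscillation over the nodes *)

Section oscillation.
Variables (R : realType) (n : nat) (f : R -> R).
Hypothesis hf : Cb f.

Lemma Cb_bounded_nodes : exists M, forall k, `|f (k%:R / n%:R)| <= M.
Proof.
have [_ [M [_ hM]]] := hf.
(* Boundedness provides a bound for every real strictly above [M]. *)
exists (M + 1) => k; apply: hM; first by rewrite ltrDl.
by rewrite /= in_itv /= andbT divr_ge0.
Qed.

Lemma le_osc_lt k l : (k < l)%N ->
  `|f (k%:R / n%:R) - f (l%:R / n%:R)| <= osc n f.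
Proof.
move=> kl; have [M hM] := Cb_bounded_nodes.
apply: ub_le_sup; last by exists k, l.
(* [sup] dominates its set only if the set is bounded above; the triangle inequality gives
   [M + M]. *)
exists (M + M) => _ [i [j [_ ->]]].
by rewrite (le_trans (ler_normB _ _))// lerD.
Qed.

Lemma osc_ge0 : 0 <= osc n f.
Proof. exact: le_trans (normr_ge0 _) (le_osc_lt 0 1 (ltnSn 0)). Qed.

(** Symmetry and the trivial diagonal remove the restriction [k < l], as the covariance bound ranges
    over all pairs. *)
Lemma le_osc k l : `|f (k%:R / n%:R) - f (l%:R / n%:R)| <= osc n f.
Proof.
case: (ltngtP k l) => [|lk|->]; first exact: le_osc_lt.
  by rewrite distrC le_osc_lt.
by rewrite subrr normr0 osc_ge0.
Qed.
End oscillation.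

Theorem theorem7p1 (R : realType) (n : nat) (hn : (1 <= n)%N)
    (f g : R -> R) (hf : Cb f) (hg : Cb g) (x : R) (hx : 0 <= x) :
  `|chebyshev_T n f g x| <= 1 / 2 * (1 - vartheta n x) * osc n f * osc n g /\
  1 / 2 * (1 - vartheta n x) * osc n f * osc n g
    <= 1 / 2 * (1 - epsilon R n) * osc n f * osc n g.
Proof.
split.
  have [Mf hMf] := Cb_bounded_nodes _ n _ hf.
  have [Mg hMg] := Cb_bounded_nodes _ n _ hg.
  rewrite /chebyshev_T !baskakovE varthetaE//.
  apply: (weighted_covariance_lim_le _ _ _ _ Mf Mg) => //.
  - exact: baskakov_weight_ge0.
  - exact: cvg_series_baskakov_weight.
  - exact: le_osc.
  - exact: le_osc.
(* The oscillations are nonnegative, so only the comparison of [epsilon] with [vartheta] remains. *)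
rewrite ler_wpM2r ?osc_ge0// ler_wpM2r ?osc_ge0// ler_wpM2l ?divr_ge0//.
by rewrite lerD2l lerN2 epsilon_le_vartheta.
Qed.
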